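(* Let $A$ be a connected weakly symmetric algebra fulfilling the Tachikawa conjecture (for example, take $A$ to be a block of the group algebra of a finite group) and let $F:mod(B)\to mod(A)$ be a homological embedding, where $B$ is a finite dimensional $\mathbb{K}$-algebra. Then $F$ is either zero or an equivalence.
   Context: $\mathbb{K}$ is an algebraically closed field; all algebras are finite dimensional $\mathbb{K}$-algebras, and $mod(A)$ is the category of finite dimensional left $A$-modules. An algebra $A$ is weakly symmetric if it is self-injective and $top(P)\cong soc(P)$ for all indecomposable projective $A$-modules $P$. A self-injective algebra $A$ fulfils the Tachikawa conjecture if every finite dimensional $A$-module $M$ with $Ext^i_A(M,M)=0$ for all $i>0$ is projective. A fully faithful exact functor $F:mod(B)\to mod(A)$ is a homological embedding if it induces isomorphisms $Ext^i_B(X,Y)\cong Ext^i_A(F(X),F(Y))$ for all $i>0$ and all $X,Y\in mod(B)$. *)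

(* Defs.v *)
From mathcomp Require Import all_boot all_order all_algebra.
From Stdlib Require Import Relation_Operators.

Set Implicit Arguments.
Unset Strict Implicit.
Unset Printing Implicit Defensive.

Import GRing.Theory.
Local Open Scope ring_scope.

(* The algebra structures of the library exclude the zero ring.  It has to be
   allowed here: the zero functor is fully faithful only on the modules over
   the zero algebra. *)
Record fdalg (K : fieldType) := FdAlg {
  alg_carrier :> vectType K;
  alg_one : alg_carrier;
  alg_mul : alg_carrier -> alg_carrier -> alg_carrier;
  alg_mul_linear_l : forall k a b c,
    alg_mul (k *: a + b) c = k *: alg_mul a c + alg_mul b c;
  alg_mul_linear_r : forall k a b c,
    alg_mul a (k *: b + c) = k *: alg_mul a b + alg_mul a c;
  alg_mulA : forall a b c, alg_mul a (alg_mul b c) = alg_mul (alg_mul a b) c;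
  alg_mul1l : forall a, alg_mul alg_one a = a;
  alg_mul1r : forall a, alg_mul a alg_one = a
}.

Arguments alg_one {K A} : rename.

Section Modules.
Variables (K : fieldType) (A : fdalg K).

Record fdmod := FdMod {
  carrier :> vectType K;
  act : A -> carrier -> carrier;
  act_linear_l : forall x k a b, act (k *: a + b) x = k *: act a x + act b x;
  act_linear_r : forall a k x y, act a (k *: x + y) = k *: act a x + act a y;
  act1 : forall x, act alg_one x = x;
  actM : forall a b x, act (alg_mul a b) x = act a (act b x)
}.

Definition regular : fdmod :=
  @FdMod A (@alg_mul K A) (fun x k a b => alg_mul_linear_l k a b x)
    (fun a k x y => alg_mul_linear_r k a x y) (@alg_mul1l K A)
    (fun a b x => esym (alg_mulA a b x)).

Record mhom (M N : fdmod) := MHom {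
  mhom_fun :> 'Hom(M, N);
  mhomP : forall a x, mhom_fun (act a x) = act a (mhom_fun x)
}.

Lemma mhom_id_subproof (M : fdmod) a (x : M) :
  (\1%VF : 'End(M)) (act a x) = act a ((\1%VF : 'End(M)) x).
Proof. by rewrite !id_lfunE. Qed.

Definition mhom_id M : mhom M M := MHom (@mhom_id_subproof M).

Lemma mhom_comp_subproof (L M N : fdmod) (g : mhom M N) (f : mhom L M) a x :
  (g \o f)%VF (act a x) = act a ((g \o f)%VF x).
Proof. by rewrite !comp_lfunE !mhomP. Qed.

Definition mhom_comp (L M N : fdmod) (g : mhom M N) (f : mhom L M) : mhom L N :=
  MHom (mhom_comp_subproof g f).

Lemma mhom_add_subproof (M N : fdmod) (f g : mhom M N) a x :
  (mhom_fun f + mhom_fun g) (act a x) = act a ((mhom_fun f + mhom_fun g) x).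
Proof.
rewrite !add_lfunE !mhomP.
by have := act_linear_r a 1 (f x) (g x); rewrite !scale1r.
Qed.

Definition mhom_add (M N : fdmod) (f g : mhom M N) : mhom M N :=
  MHom (mhom_add_subproof f g).

Definition is_iso (M N : fdmod) (f : mhom M N) : Prop :=
  exists g : mhom N M, mhom_comp g f = mhom_id M /\ mhom_comp f g = mhom_id N.

Definition isomorphic (M N : fdmod) : Prop := exists f : mhom M N, is_iso f.

Definition surj (M N : fdmod) (f : mhom M N) : Prop :=
  forall y, exists x, f x = y.

Definition short_exact (L M N : fdmod) (i : mhom L M) (p : mhom M N) : Prop :=
  [/\ injective i, surj p & forall x, p x = 0 <-> exists z, i z = x].

Definition projective (P : fdmod) : Prop :=
  forall (M N : fdmod) (p : mhom M N) (g : mhom P N), surj p ->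
  exists h : mhom P M, mhom_comp p h = g.

Definition injective_mod (I : fdmod) : Prop :=
  forall (M N : fdmod) (i : mhom M N) (g : mhom M I), injective i ->
  exists h : mhom N I, mhom_comp h i = g.

Section Submodules.
Variable M : fdmod.
Implicit Types U V : {vspace M}.

Definition submodule U : Prop := forall a x, x \in U -> act a x \in U.

Definition simple_sub U : Prop :=
  [/\ submodule U, U != 0%VS &
      forall V, submodule V -> (V <= U)%VS -> V = 0%VS \/ V = U].

Definition maximal_sub U : Prop :=
  [/\ submodule U, U != fullv &
      forall V, submodule V -> (U <= V)%VS -> V = U \/ V = fullv].

Definition in_rad (x : M) : Prop := forall U, maximal_sub U -> x \in U.

(* The sum of the simple submodules, as the smallest submodule that contains
   all of them. *)
Definition in_soc (x : M) : Prop :=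
  forall U, submodule U -> (forall S, simple_sub S -> (S <= U)%VS) -> x \in U.

Definition indecomposable : Prop :=
  (exists x : M, x != 0) /\
  forall U V, submodule U -> submodule V ->
    (U + V)%VS = fullv -> (U :&: V)%VS = 0%VS -> U = 0%VS \/ V = 0%VS.

Definition is_top (T : fdmod) : Prop :=
  exists p : mhom M T, surj p /\ forall x, p x = 0 <-> in_rad x.

Definition is_soc (S : fdmod) : Prop :=
  exists i : mhom S M, injective i /\ forall x, (exists s, i s = x) <-> in_soc x.

End Submodules.

(* Extensions 0 -> Y -> E -> X -> 0. *)
Record ses (X Y : fdmod) := Ses {
  mid : fdmod;
  ses_inj : mhom Y mid;
  ses_proj : mhom mid X;
  ses_exact : short_exact ses_inj ses_proj
}.

Definition ses_mor (X Y X' Y' : fdmod) (al : mhom X X') (be : mhom Y Y')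
    (s : ses X Y) (s' : ses X' Y') : Prop :=
  exists ep : mhom (mid s) (mid s'),
    mhom_comp ep (ses_inj s) = mhom_comp (ses_inj s') be /\
    mhom_comp (ses_proj s') ep = mhom_comp al (ses_proj s).

(* [yext n X Y] is the type of the (n + 1)-fold Yoneda extensions of X by Y,
     0 -> Y -> E_(n+1) -> ... -> E_1 -> X -> 0,
   given as the splice of 0 -> Z -> E_1 -> X -> 0 and of an n-fold extension
   of Z by Y, where Z is the kernel of E_1 -> X. *)
Fixpoint yext (n : nat) (X Y : fdmod) : Type :=
  if n is n'.+1 then {Z : fdmod & (ses X Z * yext n' Z Y)%type} else ses X Y.

(* Morphisms of exact sequences with prescribed end maps. *)
Fixpoint yext_mor (n : nat) : forall X Y X' Y' : fdmod,
    mhom X X' -> mhom Y Y' -> yext n X Y -> yext n X' Y' -> Prop :=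
  if n is n'.+1 then
    fun X Y X' Y' al be e e' =>
      exists ze : mhom (projT1 e) (projT1 e'),
        ses_mor al ze (projT2 e).1 (projT2 e').1 /\
        yext_mor ze be (projT2 e).2 (projT2 e').2
  else fun X Y X' Y' al be s s' => ses_mor al be s s'.

(* Ext^(n+1)_A(X, Y) is the quotient of [yext n X Y] by [yext_eq]. *)
Definition yext_eq (n : nat) (X Y : fdmod) : yext n X Y -> yext n X Y -> Prop :=
  clos_refl_sym_trans _ (yext_mor (mhom_id X) (mhom_id Y)).

(* Ext^(n+1)_A(X, Y) = 0; the class of the zero extension is always there, so
   the quotient vanishes when it has just one element. *)
Definition Ext_vanishes (n : nat) (X Y : fdmod) : Prop :=
  forall e e' : yext n X Y, yext_eq e e'.

End Modules.

Section AlgebraProperties.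
Variables (K : fieldType) (A : fdalg K).

Definition connected : Prop :=
  (alg_one : A) != 0 /\
  forall e : A, alg_mul e e = e -> (forall a, alg_mul a e = alg_mul e a) ->
    e = 0 \/ e = alg_one.

Definition self_injective : Prop := injective_mod (regular A).

Definition weakly_symmetric : Prop :=
  self_injective /\
  forall P : fdmod A, projective P -> indecomposable P ->
  exists T S : fdmod A, [/\ is_top P T, is_soc P S & isomorphic T S].

Definition Tachikawa : Prop :=
  forall M : fdmod A, (forall n, Ext_vanishes n M M) -> projective M.

End AlgebraProperties.

Record functor (K : fieldType) (B A : fdalg K) := Functor {
  fobj :> fdmod B -> fdmod A;
  fmap : forall X Y, mhom X Y -> mhom (fobj X) (fobj Y);
  fmap_id : forall X, fmap (mhom_id X) = mhom_id (fobj X);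
  fmap_comp : forall X Y Z (g : mhom Y Z) (f : mhom X Y),
    fmap (mhom_comp g f) = mhom_comp (fmap g) (fmap f)
}.

Definition functor_id (K : fieldType) (A : fdalg K) : functor A A :=
  @Functor K A A id (fun _ _ f => f) (fun _ => erefl) (fun _ _ _ _ _ => erefl).

Section FunctorComp.
Variables (K : fieldType) (A B C : fdalg K).
Variables (G : functor B C) (F : functor A B).

Lemma functor_comp_id X :
  fmap G (fmap F (mhom_id X)) = mhom_id (G (F X)).
Proof. by rewrite !fmap_id. Qed.

Lemma functor_comp_comp X Y Z (g : mhom Y Z) (f : mhom X Y) :
  fmap G (fmap F (mhom_comp g f)) =
  mhom_comp (fmap G (fmap F g)) (fmap G (fmap F f)).
Proof. by rewrite !fmap_comp. Qed.

Definition functor_comp : functor A C :=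
  @Functor K A C (fun X => G (F X)) (fun _ _ f => fmap G (fmap F f))
    functor_comp_id functor_comp_comp.

End FunctorComp.

Definition naturally_isomorphic (K : fieldType) (B A : fdalg K)
    (F G : functor B A) : Prop :=
  exists eta : forall X, mhom (F X) (G X),
    (forall X, is_iso (eta X)) /\
    forall X Y (f : mhom X Y),
      mhom_comp (eta Y) (fmap F f) = mhom_comp (fmap G f) (eta X).

Section FunctorProperties.
Variables (K : fieldType) (B A : fdalg K).

Definition equivalence (F : functor B A) : Prop :=
  exists G : functor A B,
    naturally_isomorphic (functor_comp G F) (functor_id B) /\
    naturally_isomorphic (functor_comp F G) (functor_id A).

Definition zero_functor (F : functor B A) : Prop :=
  forall (X : fdmod B) (x : F X), x = 0.

Definition fully_faithful (F : functor B A) : Prop :=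
  forall X Y, bijective (@fmap K B A F X Y).

Definition exact_functor (F : functor B A) : Prop :=
  (forall X Y (f g : mhom X Y),
     fmap F (mhom_add f g) = mhom_add (fmap F f) (fmap F g)) /\
  (forall X Y Z (i : mhom X Y) (p : mhom Y Z),
     short_exact i p -> short_exact (fmap F i) (fmap F p)).

Section ExtMap.
Variables (F : functor B A) (exF : exact_functor F).

Definition ses_map X Y (s : ses X Y) : ses (F X) (F Y) :=
  Ses (proj2 exF _ _ _ _ _ (ses_exact s)).

Fixpoint yext_map (n : nat) : forall X Y, yext n X Y -> yext n (F X) (F Y) :=
  if n is n'.+1 then
    fun X Y e =>
      existT (fun Z => (ses (F X) Z * yext n' Z (F Y))%type) (F (projT1 e))
        (ses_map (projT2 e).1, yext_map (projT2 e).2)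
  else fun X Y s => ses_map s.

(* The map induced by F on Ext^(n+1) is bijective.  It is additive, because an
   exact functor preserves Baer sums, so that it is then an isomorphism. *)
Definition Ext_iso (n : nat) (X Y : fdmod B) : Prop :=
  (forall e e' : yext n X Y,
     yext_eq (yext_map e) (yext_map e') -> yext_eq e e') /\
  (forall d : yext n (F X) (F Y), exists e, yext_eq (yext_map e) d).

End ExtMap.

Definition homological_embedding (F : functor B A) : Prop :=
  fully_faithful F /\ exists exF : exact_functor F, forall n X Y, Ext_iso exF n X Y.

End FunctorProperties.

(* Main.v *)
From HB Require Import structures.
Require Import Defs.
From mathcomp Require Import all_boot all_order all_algebra.
From Stdlib Require Import Classical ClassicalEpsilon.
From Stdlib Require Import Relation_Operators.

Set Implicit Arguments.
Unset Strict Implicit.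
Unset Printing Implicit Defensive.

Import GRing.Theory.
Local Open Scope ring_scope.

(** Let M be the image under F of the regular B-module.  The regular module is
    projective, so that its self-extensions vanish; the bijections on Ext carry
    this over to M, and M is projective by the Tachikawa property.  Nothing else
    about Ext is used: what remains holds for every fully faithful exact functor
    that sends the regular module to a projective module over a connected weakly
    symmetric algebra.

    Weak symmetry says that a simple module T is a quotient of an indecomposable
    projective P if and only if it is a submodule of P ([top_in_socle],
    [socle_in_top]).  If T is a quotient of F X, then it is a quotient of M, hence
    a submodule of M, and F X -> T -> M is a map between images of F.  Its kernel
    is again an image of F, since F is exact and full.  Peeling off simple
    quotients in this way shows that every nonzero subquotient Q of F X satisfies
    Hom(M, Q) <> 0 ([has_hom_subquotient]).

    Now let P be indecomposable projective with Hom(M, P) <> 0.  A simple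
    submodule of the image of a map M -> P is a quotient of M by the previous
    step and a quotient of P by weak symmetry.  As P is local, a lift M -> P is
    onto ([cover_or_no_hom]).  So the indecomposable summands of the regular
    A-module are either covered by M or receive no nonzero map from M.  There are
    no nonzero maps in either direction between the sum of the former and that
    of the latter, so these are two ideals which annihilate each other, and by
    connectedness one of them is zero ([generator_or_zero]).

    If M is zero, then so is F.  Otherwise every A-module has a presentation by
    modules F X; its first map comes from B, whose cokernel is sent to the given
    module.  Hence F is essentially surjective. *)

(** * Homomorphisms of modules *)

Section Homomorphisms.
Variables (K : fieldType) (A : fdalg K).
Implicit Types L M N : fdmod A.

Lemma actD M (a : A) (x y : M) : act a (x + y) = act a x + act a y.
Proof. by have := act_linear_r a 1 x y; rewrite !scale1r. Qed.

Lemma act0 M (a : A) : act a (0 : M) = 0.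
Proof. by apply: (addrI (act a (0 : M))); rewrite -actD !addr0. Qed.

Lemma actB M (a : A) (x y : M) : act a (x - y) = act a x - act a y.
Proof. by rewrite addrC -scaleN1r act_linear_r scaleN1r addrC. Qed.

Lemma actDl M (a b : A) (x : M) : act (a + b) x = act a x + act b x.
Proof. by have := act_linear_l x 1 a b; rewrite !scale1r. Qed.

Lemma act0l M (x : M) : act (0 : A) x = 0.
Proof. by apply: (addrI (act (0 : A) x)); rewrite -actDl !addr0. Qed.

Lemma mhom0 M N (f : mhom M N) : f 0 = 0.
Proof. exact: linear0. Qed.

Lemma mhomD M N (f : mhom M N) x y : f (x + y) = f x + f y.
Proof. exact: linearD. Qed.

Lemma mhomB M N (f : mhom M N) x y : f (x - y) = f x - f y.
Proof. exact: linearB. Qed.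

Lemma mhomL M N (f : mhom M N) k x y : f (k *: x + y) = k *: f x + f y.
Proof. exact: linearP. Qed.

Lemma mhom_ext M N (f g : mhom M N) : (forall x, f x = g x) -> f = g.
Proof.
case: f => f hf; case: g => g hg /= fg.
have E : f = g by apply/lfunP.
by subst g; rewrite (proof_irrelevance _ hf hg).
Qed.

Lemma mhom_ofP M N (f : M -> N) :
  (forall k x y, f (k *: x + y) = k *: f x + f y) ->
  (forall a x, f (act a x) = act a (f x)) ->
  exists h : mhom M N, forall x, h x = f x.
Proof.
move=> flin fact.
pose fL := GRing.isLinear.Build K M N *:%R f flin.
pose f' : {linear M -> N} := HB.pack f fL.
have fE x : (linfun f') x = f x by rewrite lfunE.
have hP a x : (linfun f') (act a x) = act a ((linfun f') x) by rewrite !fE fact.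
by exists (MHom hP).
Qed.

Lemma mhom_compE L M N (g : mhom M N) (f : mhom L M) x :
  mhom_comp g f x = g (f x).
Proof. by rewrite comp_lfunE. Qed.

Lemma mhom_idE M (x : M) : mhom_id M x = x.
Proof. by rewrite id_lfunE. Qed.

Lemma mhom_addE M N (f g : mhom M N) x : mhom_add f g x = f x + g x.
Proof. by rewrite add_lfunE. Qed.

Lemma mhom_zeroP M N : exists h : mhom M N, forall x, h x = 0.
Proof.
by apply: mhom_ofP => [k x y|a x]; rewrite ?scaler0 ?addr0 ?act0.
Qed.

Lemma mhom_injP M N (f : mhom M N) :
  injective f <-> forall x, f x = 0 -> x = 0.
Proof.
split=> [fi x fx|f0 x y fxy]; first by apply: fi; rewrite fx mhom0.
by apply/eqP; rewrite -subr_eq0; apply/eqP/f0; rewrite mhomB fxy subrr.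
Qed.

Lemma lift_along_inj L M N (i : mhom L M) (f : mhom N M) :
  injective i -> (forall x, exists z, i z = f x) ->
  exists h : mhom N L, forall x, i (h x) = f x.
Proof.
move=> ii fi.
pose h x := ((mhom_fun i)^-1%VF) (f x).
have hE x : i (h x) = f x.
  by apply: limg_lfunVK; have [z <-] := fi x; apply: memv_img (memvf _).
have [|a x|h' h'E] := @mhom_ofP N L h.
- by move=> k x y; rewrite /h ?linearP ?mhomL.
- by apply: ii; rewrite mhomP !hE mhomP.
by exists h' => x; rewrite h'E.
Qed.

Lemma factor_through_surj L M N (p : mhom M N) (f : mhom M L) :
  surj p -> (forall x, p x = 0 -> f x = 0) ->
  exists h : mhom N L, forall x, h (p x) = f x.
Proof.
move=> ps fp.
pose h y := f (((mhom_fun p)^-1%VF) y).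
have hE x : h (p x) = f x.
  apply/eqP; rewrite -subr_eq0 -mhomB; apply/eqP/fp.
  by rewrite mhomB limg_lfunVK ?subrr // memv_img ?memvf.
have [|a y|h' h'E] := @mhom_ofP N L h.
- by move=> k x y; rewrite /h ?linearP ?mhomL.
- by have [x <-] := ps y; rewrite -mhomP !hE mhomP.
by exists h' => x; rewrite h'E.
Qed.

Lemma is_iso_bij M N (f : mhom M N) : injective f -> surj f -> is_iso f.
Proof.
move=> fi fs.
have [|g gE] := @lift_along_inj _ _ _ f (mhom_id N) fi.
  by move=> x; have [z <-] := fs x; exists z; rewrite mhom_idE.
exists g; split; apply: mhom_ext => x; rewrite mhom_compE mhom_idE.
  by apply: fi; rewrite gE mhom_idE.
by rewrite gE mhom_idE.
Qed.

Lemma iso_of_surj L M N (p : mhom M N) (q : mhom M L) :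
  surj p -> surj q -> (forall x, p x = 0 <-> q x = 0) -> isomorphic N L.
Proof.
move=> ps qs pq.
have [h hE] := factor_through_surj ps (fun x => proj1 (pq x)).
exists h; apply: is_iso_bij.
  by apply/mhom_injP => y; have [x <-] := ps y; rewrite hE => /pq.
by move=> z; have [x <-] := qs z; exists (p x).
Qed.

Lemma sub_limg M N (f : mhom M N) : submodule (limg f).
Proof.
by move=> a y /memv_imgP[x _ ->]; rewrite -mhomP memv_img ?memvf.
Qed.

Lemma sub_lker M N (f : mhom M N) : submodule (lker f).
Proof.
by move=> a x; rewrite !memv_ker => /eqP fx; rewrite mhomP fx act0.
Qed.

Lemma mem_limg M N (f : mhom M N) y : y \in limg f <-> exists x, f x = y.
Proof.
split=> [/memv_imgP[x _ ->]|[x <-]]; [by exists x | by rewrite memv_img ?memvf].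
Qed.

Lemma surj_limg M N (f : mhom M N) : surj f <-> limg f = fullv.
Proof.
split=> [fs|fE y]; last by apply/mem_limg; rewrite fE memvf.
by apply/vspaceP => y; rewrite memvf; apply/mem_limg.
Qed.

Lemma submodule_module M (U : {vspace M}) : submodule U ->
  exists (N : fdmod A) (i : mhom N M),
    injective i /\ forall x, x \in U <-> exists z, i z = x.
Proof.
move=> sU.
pose ac (a : A) (u : subvs_of U) := vsproj U (act a (vsval u)).
have acE a u : vsval (ac a u) = act a (vsval u).
  by rewrite vsprojK ?sU ?subvsP.
have h1 (u : subvs_of U) k a b : ac (k *: a + b) u = k *: ac a u + ac b u.
  by apply: val_inj; rewrite /= acE act_linear_l -!acE.
have h2 a k (u v : subvs_of U) : ac a (k *: u + v) = k *: ac a u + ac a v.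
  by apply: val_inj; rewrite /= acE linearP /= act_linear_r -!acE.
have h3 (u : subvs_of U) : ac alg_one u = u.
  by apply: val_inj; rewrite /= acE act1.
have h4 a b (u : subvs_of U) : ac (alg_mul a b) u = ac a (ac b u).
  by apply: val_inj; rewrite /= !acE actM.
pose N := @FdMod K A (subvs_of U) ac h1 h2 h3 h4.
have [| |i iE] := @mhom_ofP N M (fun u : subvs_of U => vsval u).
- by move=> k x y; rewrite linearP.
- by move=> a x; rewrite acE.
exists N, i; split=> [u v|x].
  by rewrite !iE => /val_inj.
split=> [xU|[z <-]]; first by exists (vsproj U x); rewrite iE vsprojK.
by rewrite iE subvsP.
Qed.

Lemma image_factorization M N (f : mhom M N) :
  exists (I : fdmod A) (p : mhom M I) (i : mhom I N),
    [/\ surj p, injective i & forall x, i (p x) = f x].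
Proof.
have [I [i [ii iU]]] := submodule_module (@sub_limg M N f).
have [p pE] : exists p : mhom M I, forall x, i (p x) = f x.
  by apply: lift_along_inj => // x; apply/iU/mem_limg; exists x.
exists I, p, i; split=> // y.
have /mem_limg[x xE] : i y \in limg f by apply/iU; exists y.
by exists x; apply: ii; rewrite pE.
Qed.

(** The quotient by U is realised on a complement of U, so that it is again a
    space of the same kind as the submodules. *)
Lemma vspace_quotient (V : vectType K) (U : {vspace V}) :
  exists (W : {vspace V}) (pr : V -> subvs_of W),
  [/\ forall k x y, pr (k *: x + y) = k *: pr x + pr y,
      forall x, pr x = 0 <-> x \in U, forall u, pr (vsval u) = u
    & forall x, x - vsval (pr x) \in U].
Proof.
pose W := (U^C)%VS.
have dUW : (W :&: U = 0)%VS by rewrite capvC capv_compl.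
pose pr x := vsproj W (daddv_pi W U x).
have prE x : vsval (pr x) = daddv_pi W U x by rewrite vsprojK ?memv_pi.
have prD x : x - vsval (pr x) = daddv_pi U W x.
  apply/eqP; rewrite subr_eq prE addrC eq_sym; apply/eqP.
  by apply: daddv_pi_add => //; rewrite addvC addv_complf memvf.
have prU x : x - vsval (pr x) \in U by rewrite prD memv_pi.
have prs u : pr (vsval u) = u.
  by apply: val_inj; rewrite /= prE daddv_pi_id ?subvsP.
exists W, pr; split=> // [k x y|x]; first by rewrite /pr !linearP.
have v0 : vsval (0 : subvs_of W) = 0 by exact: linear0.
split=> [px|xU]; first by have := prU x; rewrite px v0 subr0.
apply/val_inj/eqP; rewrite /= -memv0 -dUW memv_cap subvsP /=.
by rewrite -[vsval _](subKr x) rpredB.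
Qed.

Lemma quotient_module M (U : {vspace M}) : submodule U ->
  exists (Q : fdmod A) (p : mhom M Q), surj p /\ forall x, p x = 0 <-> x \in U.
Proof.
move=> sU.
have [W [pr [prlin pr0 prs prU]]] := vspace_quotient U.
have prB x y : pr (x - y) = pr x - pr y.
  by rewrite -scaleN1r addrC prlin scaleN1r addrC.
pose ac (a : A) (u : subvs_of W) := pr (act a (vsval u)).
have acE a x : ac a (pr x) = pr (act a x).
  apply/eqP; rewrite eq_sym -subr_eq0 -prB -actB; apply/eqP/pr0.
  by apply: sU.
have h1 (u : subvs_of W) k a b : ac (k *: a + b) u = k *: ac a u + ac b u.
  by rewrite /ac act_linear_l prlin.
have h2 a k (u v : subvs_of W) : ac a (k *: u + v) = k *: ac a u + ac a v.
  by rewrite /ac linearP act_linear_r prlin.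
have h3 (u : subvs_of W) : ac alg_one u = u by rewrite /ac act1 prs.
have h4 a b (u : subvs_of W) : ac (alg_mul a b) u = ac a (ac b u).
  by rewrite [ac b u]/ac acE /ac actM.
pose Q := @FdMod K A (subvs_of W) ac h1 h2 h3 h4.
have [| |p pE] := @mhom_ofP M Q pr; [exact: prlin | by move=> a x; rewrite -acE |].
exists Q, p; split=> [u|x]; last by rewrite pE.
by exists (vsval (u : subvs_of W)); rewrite pE prs.
Qed.

Lemma biproduct M N :
  exists (D : fdmod A) (i1 : mhom M D) (i2 : mhom N D)
         (p1 : mhom D M) (p2 : mhom D N),
  [/\ (forall x, p1 (i1 x) = x) /\ (forall y, p2 (i2 y) = y),
      forall x, p2 (i1 x) = 0, forall y, p1 (i2 y) = 0
    & forall z, z = i1 (p1 z) + i2 (p2 z)].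
Proof.
pose ac (a : A) (u : M * N) : M * N := (act a u.1, act a u.2).
have h1 (u : M * N) k a b : ac (k *: a + b) u = k *: ac a u + ac b u.
  by rewrite /ac !act_linear_l.
have h2 a k (u v : M * N) : ac a (k *: u + v) = k *: ac a u + ac a v.
  by rewrite /ac /= !act_linear_r.
have h3 (u : M * N) : ac alg_one u = u by rewrite /ac !act1; case: u.
have h4 a b (u : M * N) : ac (alg_mul a b) u = ac a (ac b u).
  by rewrite /ac !actM.
pose D := @FdMod K A (M * N)%type ac h1 h2 h3 h4.
have [| |i1 i1E] := @mhom_ofP M D (fun x => (x, 0)).
- by move=> k x y; congr pair; rewrite /= scaler0 addr0.
- by move=> a x; congr pair; rewrite /= act0.
have [| |i2 i2E] := @mhom_ofP N D (fun x => (0, x)).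
- by move=> k x y; congr pair; rewrite /= scaler0 addr0.
- by move=> a x; congr pair; rewrite /= act0.
have [| |p1 p1E] := @mhom_ofP D M (fun x : M * N => x.1); [by [] | by [] |].
have [| |p2 p2E] := @mhom_ofP D N (fun x : M * N => x.2); [by [] | by [] |].
exists D, i1, i2, p1, p2; split; first by split=> x; rewrite ?p1E ?p2E ?i1E ?i2E.
- by move=> x; rewrite p2E i1E.
- by move=> x; rewrite p1E i2E.
move=> z; rewrite p1E p2E i1E i2E; case: z => x y.
by congr pair; rewrite ?addr0 ?add0r.
Qed.

End Homomorphisms.

Arguments sub_limg {K A M N} f.
Arguments sub_lker {K A M N} f.

(** * Simple modules *)

Section SimpleModules.
Variables (K : fieldType) (A : fdalg K).
Implicit Types L M N T : fdmod A.

Definition simple T : Prop :=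
  (exists x : T, x != 0) /\
  forall U : {vspace T}, submodule U -> U = 0%VS \/ U = fullv.

Definition has_hom M N : Prop := exists (f : mhom M N) (x : M), f x != 0.

Lemma no_hom M N : ~ has_hom M N -> forall (f : mhom M N) x, f x = 0.
Proof. by move=> n f x; apply/eqP/negPn/negP => fx; apply: n; exists f, x. Qed.

Lemma has_hom_comp L M N (g : mhom M N) (f : mhom L M) x :
  g (f x) != 0 -> has_hom L N.
Proof. by move=> gfx; exists (mhom_comp g f), x; rewrite mhom_compE. Qed.

Lemma lker_inj M N (f : mhom M N) : injective f <-> lker f = 0%VS.
Proof.
split=> [fi|f0].
  apply/eqP; rewrite -subv0; apply/subvP => x; rewrite memv_ker memv0 => /eqP fx.
  by apply/eqP; apply: (proj1 (mhom_injP f) fi).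
by apply/mhom_injP => x fx; apply/eqP; rewrite -memv0 -f0 memv_ker fx.
Qed.

Lemma simple_inj T N (f : mhom T N) x : simple T -> f x != 0 -> injective f.
Proof.
move=> [_ sT] fx; apply/lker_inj; case: (sT _ (sub_lker f)) => // kE.
by move: (memvf x); rewrite -kE memv_ker (negPf fx).
Qed.

Lemma simple_surj M T (f : mhom M T) x : simple T -> f x != 0 -> surj f.
Proof.
move=> [_ sT] fx; apply/surj_limg; case: (sT _ (sub_limg f)) => // iE.
have : f x \in limg f by apply/mem_limg; exists x.
by rewrite iE memv0 (negPf fx).
Qed.

Lemma surj_inverse M N (f : mhom M N) : injective f -> surj f ->
  exists g : mhom N M, (forall y, f (g y) = y) /\ forall x, g (f x) = x.
Proof.
move=> fi fs; have [g gE] := @lift_along_inj _ _ _ _ _ f (mhom_id N) fi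
  (fun y => fs (mhom_id N y)).
have fg y : f (g y) = y by rewrite gE mhom_idE.
by exists g; split=> // x; apply: fi.
Qed.

Lemma schur T T' (f : mhom T T') x : simple T -> simple T' -> f x != 0 ->
  exists g : mhom T' T, (forall y, f (g y) = y) /\ forall x, g (f x) = x.
Proof.
move=> sT sT' fx.
by apply: surj_inverse; [apply: simple_inj fx | apply: simple_surj fx].
Qed.

Lemma dim_lt_inj N M (i : mhom N M) : injective i -> ~ surj i ->
  (\dim {:N} < \dim {:M})%N.
Proof.
move=> ii ns.
rewrite -(@limg_dim_eq _ _ _ i fullv); last by rewrite (proj1 (lker_inj i) ii) capv0.
rewrite ltn_neqAle dimvS ?subvf // andbT; apply/negP => dE.
by apply/ns/surj_limg/eqP; rewrite eqEdim subvf (eqP dE) leqnn.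
Qed.

Lemma dim_lt_surj M N (p : mhom M N) x : surj p -> x != 0 -> p x = 0 ->
  (\dim {:N} < \dim {:M})%N.
Proof.
move=> /surj_limg ps x0 px.
have := limg_ker_dim (mhom_fun p) fullv; rewrite ps capfv => <-.
rewrite -[X in (X < _)%N]add0n ltn_add2r lt0n dimv_eq0; apply/eqP => kE.
by move: (memv_ker p x); rewrite kE memv0 (negPf x0) px eqxx.
Qed.

Lemma not_simple M (x : M) : x != 0 -> ~ simple M ->
  exists U : {vspace M}, [/\ submodule U, U <> 0%VS & U <> fullv].
Proof.
move=> x0 ns; apply: NNPP => nU; apply: ns; split; first by exists x.
move=> U sU; apply: NNPP => nE; apply: nU; exists U.
by split=> // UE; apply: nE; [left | right].
Qed.

Lemma nonzero_elt M (U : {vspace M}) : U <> 0%VS -> exists2 x, x \in U & x != 0.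
Proof.
move=> U0; apply: NNPP => nx; apply/U0/eqP; rewrite -subv0; apply/subvP => x xU.
by rewrite memv0; apply/negPn/negP => x0; apply: nx; exists x.
Qed.

Lemma simple_submodule M (x : M) : x != 0 ->
  exists (T : fdmod A) (i : mhom T M), simple T /\ injective i.
Proof.
have [n] := ubnP (\dim {:M}); elim: n M x => // n IH M x leMn x0.
have [sM|nM] := classic (simple M).
  by exists M, (mhom_id M); split=> // y z; rewrite !mhom_idE.
have [U [sU U0 U1]] := not_simple x0 nM.
have [N [i [ii iU]]] := submodule_module sU.
have [y yU y0] := nonzero_elt U0.
have [z zE] := proj1 (iU y) yU.
have z0 : z != 0 by apply: contraNneq y0 => z0; rewrite -zE z0 mhom0.
have [|T [j [sT ji]]] := IH N z _ z0.
  rewrite -ltnS; apply: leq_trans leMn; rewrite ltnS; apply: dim_lt_inj ii _.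
  move=> is_; apply: U1; apply/vspaceP => w; rewrite memvf; apply/iU.
  exact: is_.
exists T, (mhom_comp i j); split=> // u v.
by rewrite !mhom_compE => /ii/ji.
Qed.

Lemma simple_quotient M (x : M) : x != 0 ->
  exists (T : fdmod A) (p : mhom M T), simple T /\ surj p.
Proof.
have [n] := ubnP (\dim {:M}); elim: n M x => // n IH M x leMn x0.
have [sM|nM] := classic (simple M).
  by exists M, (mhom_id M); split=> // y; exists y; rewrite mhom_idE.
have [U [sU U0 U1]] := not_simple x0 nM.
have [Q [p [ps pU]]] := quotient_module sU.
have [y yU y0] := nonzero_elt U0.
have [z z0] : exists z, p z != 0.
  apply: NNPP => nz; apply/U1/vspaceP => w; rewrite memvf; apply/pU/eqP/negPn.
  by apply/negP => pw; apply: nz; exists w.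
have [|T [q [sT qs]]] := IH Q (p z) _ z0.
  rewrite -ltnS; apply: leq_trans leMn; rewrite ltnS.
  by apply: dim_lt_surj ps y0 _; apply/pU.
exists T, (mhom_comp q p); split=> // u.
by have [v <-] := qs u; have [w <-] := ps v; exists w; rewrite mhom_compE.
Qed.

Lemma maximal_quotient_simple M Q (p : mhom M Q) (U : {vspace M}) :
  maximal_sub U -> surj p -> (forall x, p x = 0 <-> x \in U) -> simple Q.
Proof.
move=> [sU U1 maxU] ps pU; split.
  apply: NNPP => nQ; move/eqP: U1; apply; apply/vspaceP => w; rewrite memvf.
  by apply/pU/eqP/negPn/negP => pw; apply: nQ; exists (p w).
move=> V sV; have memV x : x \in (mhom_fun p @^-1: V)%VS = (p x \in V).
  by rewrite memv_preim.
case: (maxU (mhom_fun p @^-1: V)%VS) => [a x|||].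
- by rewrite !memV mhomP; apply: sV.
- by apply/subvP => x /pU xU; rewrite memV xU mem0v.
- move=> VE; left; apply/eqP; rewrite -subv0; apply/subvP => y yV.
  have [x xE] := ps y; move: yV; rewrite -xE -memV VE memv0 => /pU ->.
  exact: eqxx.
- move=> VE; right; apply/vspaceP => y; rewrite memvf.
  by have [x <-] := ps y; rewrite -memV VE memvf.
Qed.

Lemma lker_maximal M T (f : mhom M T) x : simple T -> f x != 0 ->
  maximal_sub (lker f).
Proof.
move=> sT fx; have fs := simple_surj sT fx; split.
- exact: sub_lker.
- by apply/eqP => kE; move: (memvf x); rewrite -kE memv_ker (negPf fx).
move=> V sV kV.
have [|E|E] := (proj2 sT) (mhom_fun f @: V)%VS.
- move=> a _ /memv_imgP[y yV ->]; rewrite -mhomP memv_img //; exact: sV.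
- left; apply/eqP; rewrite eqEsubv kV andbT; apply/subvP => y yV.
  by rewrite memv_ker -memv0 -E memv_img.
right; apply/vspaceP => y; rewrite memvf.
have : f y \in (mhom_fun f @: V)%VS by rewrite E memvf.
case/memv_imgP => z zV fE.
rewrite -(subrK z y) rpredD //; apply: (subvP kV).
by rewrite memv_ker mhomB fE subrr.
Qed.

Lemma image_simple_sub T M (i : mhom T M) : simple T -> injective i ->
  simple_sub (limg i).
Proof.
move=> [[x x0] sT] ii; split; first exact: sub_limg.
  apply/eqP => iE; have : i x \in limg i by apply/mem_limg; exists x.
  rewrite iE memv0 => /eqP/(proj1 (mhom_injP i) ii)/eqP.
  by rewrite (negPf x0).
move=> V sV Vi; have memV y : y \in (mhom_fun i @^-1: V)%VS = (i y \in V).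
  by rewrite memv_preim.
have [|E|E] := sT (mhom_fun i @^-1: V)%VS.
- by move=> a y; rewrite !memV mhomP; apply: sV.
- left; apply/eqP; rewrite -subv0; apply/subvP => v vV.
  have /mem_limg[y yE] := subvP Vi v vV.
  by move: vV; rewrite -yE -memV E memv0 => /eqP ->; rewrite mhom0 mem0v.
right; apply/eqP; rewrite eqEsubv Vi; apply/subvP => v /mem_limg[y <-].
by rewrite -memV E memvf.
Qed.

Lemma simple_sub_module M (S : {vspace M}) : simple_sub S ->
  exists (T : fdmod A) (i : mhom T M),
    [/\ simple T, injective i & forall x, x \in S <-> exists z, i z = x].
Proof.
move=> [sS S0 minS]; have [T [i [ii iS]]] := submodule_module sS.
exists T, i; split=> //; split.
  have [x /iS[z zE] x0] := nonzero_elt (elimN eqP S0).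
  by exists z; apply: contraNneq x0 => z0; rewrite -zE z0 mhom0.
move=> U sU; have [||E|E] := minS (mhom_fun i @: U)%VS.
- by move=> a _ /memv_imgP[y yU ->]; rewrite -mhomP memv_img ?sU.
- by apply/subvP => _ /memv_imgP[y yU ->]; apply/iS; exists y.
- left; apply/eqP; rewrite -subv0; apply/subvP => y yU.
  have : i y \in (mhom_fun i @: U)%VS by rewrite memv_img.
  by rewrite E !memv0 => /eqP/(proj1 (mhom_injP i) ii) ->.
right; apply/vspaceP => y; rewrite memvf.
have : i y \in S by apply/iS; exists y.
by rewrite -E => /memv_imgP[z zU /ii ->].
Qed.

End SimpleModules.

(** * Projective modules *)

Section ProjectiveModules.
Variables (K : fieldType) (A : fdalg K).
Implicit Types L M N P T : fdmod A.

Lemma projective_lift P M N (p : mhom M N) (g : mhom P N) :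
  projective P -> surj p -> exists h : mhom P M, forall x, p (h x) = g x.
Proof.
by move=> pP ps; have [h <-] := pP M N p g ps; exists h => x; rewrite mhom_compE.
Qed.

Lemma retract_projective P N (i : mhom N P) (r : mhom P N) :
  (forall x, r (i x) = x) -> projective P -> projective N.
Proof.
move=> ri pP L M p g ps.
have [h hE] := projective_lift (mhom_comp g r) pP ps.
exists (mhom_comp h i); apply: mhom_ext => x.
by rewrite !mhom_compE hE mhom_compE ri.
Qed.

Lemma regular_hom M (m : M) : exists f : mhom (regular A) M, forall a, f a = act a m.
Proof.
by apply: mhom_ofP => [k x y|a x]; [exact: act_linear_l | exact: actM].
Qed.

Lemma regular_projective : projective (regular A).
Proof.
move=> M N p g ps; have [m mE] := ps (g (alg_one : A)).
have [h hE] := regular_hom m; exists h; apply: mhom_ext => x.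
rewrite mhom_compE hE mhomP mE -mhomP /=; congr (g _); exact: alg_mul1r.
Qed.

Fixpoint mhom_pow M (f : mhom M M) n : mhom M M :=
  if n is n'.+1 then mhom_comp f (mhom_pow f n') else mhom_id M.

Lemma mhom_powD M (f : mhom M M) m n x :
  mhom_pow f (m + n) x = mhom_pow f m (mhom_pow f n x).
Proof.
elim: m => [|m IH]; first by rewrite mhom_idE.
by rewrite addSn /= !mhom_compE IH.
Qed.

(** Fitting's lemma.  Let g be a power of f of minimal rank.  As g^2 has the same
    rank, g is injective on its image, which is therefore a complement of its
    kernel.  One of the two vanishes, and g is bijective or zero. *)
Lemma fitting P (f : mhom P P) : indecomposable P -> ~ surj f ->
  exists n, forall x, mhom_pow f n x = 0.
Proof.
move=> [_ indP] nsf.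
(* The exponent n.+1 is positive, so that f is onto whenever its power is. *)
pose d n := \dim (limg (mhom_pow f n.+1)).
have [n dmin] : exists n, forall m, (d n <= d m)%N.
  suff H k n : (d n < k)%N -> exists n, forall m, (d n <= d m)%N.
    by apply: (H (d 0%N).+1 0%N).
  elim: k n => // k IH n le_n.
  have [?|/not_all_ex_not[m /negP]] := classic (forall m, (d n <= d m)%N).
    by exists n.
  by rewrite -ltnNge => lt_m; apply: (IH m); apply: leq_trans lt_m _.
pose g := mhom_pow f n.+1.
have IE : (mhom_fun g @: limg g)%VS = limg (mhom_pow f (n + n.+1).+1).
  apply/vspaceP => y; apply/idP/idP.
    case/memv_imgP => _ /mem_limg[x <-] ->; apply/mem_limg; exists x.
    by rewrite -addSn mhom_powD.
  move=> /mem_limg[x <-]; rewrite -addSn mhom_powD memv_img //.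
  by apply/mem_limg; exists x.
have IJ0 : (limg g :&: lker g)%VS = 0%VS.
  apply/eqP; rewrite -dimv_eq0 -leqn0 -(leq_add2r (d (n + n.+1)%N)) add0n.
  rewrite {1}/d -IE limg_ker_dim; exact: dmin.
have IJ1 : (limg g + lker g)%VS = fullv.
  apply/eqP; rewrite eqEdim subvf -(limg_ker_dim (mhom_fun g) fullv) capfv.
  by rewrite dimv_disjoint_sum // [X in (_ <= X)%N]addnC leqnn.
have [I0|J0] := indP _ _ (sub_limg g) (sub_lker g) IJ1 IJ0.
  exists n.+1 => x; apply/eqP; rewrite -memv0 -I0; apply/mem_limg; by exists x.
case: nsf => y; have : y \in limg g by rewrite -[limg g]addv0 -J0 IJ1 memvf.
by move=> /mem_limg[x <-]; exists (mhom_pow f n x); rewrite -mhom_compE.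
Qed.


Lemma copairing N1 N2 P (i1 : mhom N1 P) (i2 : mhom N2 P) :
  (forall y, exists a b, y = i1 a + i2 b) ->
  exists (D : fdmod A) (p1 : mhom D N1) (p2 : mhom D N2) (q : mhom D P),
  [/\ surj q, forall z, q z = i1 (p1 z) + i2 (p2 z)
    & forall z, p1 z = 0 -> p2 z = 0 -> z = 0].
Proof.
move=> cover.
have [D [j1 [j2 [p1 [p2 [[p1j1 p2j2] p2j1 p1j2 DE]]]]]] := biproduct N1 N2.
exists D, p1, p2, (mhom_add (mhom_comp i1 p1) (mhom_comp i2 p2)).
split=> [y|z|z z1 z2]; last by rewrite (DE z) z1 z2 !mhom0 addr0.
  have [a [b ->]] := cover y; exists (j1 a + j2 b).
  rewrite mhom_addE !mhom_compE !mhomD p1j1 p2j2 p2j1 p1j2.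
  by rewrite !mhom0 addr0 add0r.
by rewrite mhom_addE !mhom_compE.
Qed.

(** Projectivity of P turns a cover of P by U and V into endomorphisms f and
    1 - f with images in U and V.  If U is proper then f is nilpotent, so that
    1 - f is onto. *)
Lemma indecomposable_projective_join P (U V : {vspace P}) :
  projective P -> indecomposable P -> submodule U -> submodule V ->
  (U + V)%VS = fullv -> U <> fullv -> V = fullv.
Proof.
move=> pP iP sU sV UV U1.
have [N1 [i1 [_ i1U]]] := submodule_module sU.
have [N2 [i2 [_ i2V]]] := submodule_module sV.
have [|D [p1 [p2 [q [qs qE _]]]]] := copairing (i1 := i1) (i2 := i2).
  move=> y; have /memv_addP[u uU [v vV ->]] : y \in (U + V)%VS by rewrite UV memvf.
  by have [a <-] := proj1 (i1U u) uU; have [b <-] := proj1 (i2V v) vV; exists a, b.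
have [s sE] := projective_lift (mhom_id P) pP qs.
pose f := mhom_comp i1 (mhom_comp p1 s).
have fU x : f x \in U by apply/i1U; exists (p1 (s x)); rewrite !mhom_compE.
have fV x : x - f x \in V.
  apply/i2V; exists (p2 (s x)); apply/eqP; rewrite eq_sym subr_eq; apply/eqP.
  by rewrite !mhom_compE addrC -qE sE mhom_idE.
have [|n fn] := fitting (f := f) iP.
  move=> fs; apply: U1; apply/vspaceP => y; rewrite memvf.
  by have [x <-] := fs y; rewrite fU.
apply/vspaceP => x; rewrite memvf -[x]subr0 -(fn x); apply/esym.
elim: n {fn} => [|n IH]; first by rewrite mhom_idE subrr mem0v.
have -> : mhom_pow f n.+1 x = f (mhom_pow f n x) by rewrite -mhom_compE.
set y := mhom_pow f n x in IH *.
have -> : x - f y = (x - y) + (y - f y) by rewrite addrA subrK.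
by rewrite rpredD.
Qed.

Lemma decomposable_split P (x : P) : x != 0 -> ~ indecomposable P ->
  exists (P1 P2 : fdmod A) (i1 : mhom P1 P) (i2 : mhom P2 P)
         (r1 : mhom P P1) (r2 : mhom P P2),
  [/\ forall y, r1 (i1 y) = y, forall y, r2 (i2 y) = y,
      forall z, z = i1 (r1 z) + i2 (r2 z), ~ surj i1 & ~ surj i2].
Proof.
move=> x0 nP.
have [U [V [sU sV [UV1 UV0 U0 V0]]]] : exists U V : {vspace P},
    [/\ submodule U, submodule V &
     [/\ (U + V)%VS = fullv, (U :&: V)%VS = 0%VS, U <> 0%VS & V <> 0%VS]].
  apply: NNPP => nUV; apply: nP; split; first by exists x.
  move=> U V sU sV UV1 UV0; apply: NNPP => nE; apply: nUV; exists U, V.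
  by split=> //; split=> // E; apply: nE; [left | right].
have [N1 [i1 [ii1 i1U]]] := submodule_module sU.
have [N2 [i2 [ii2 i2V]]] := submodule_module sV.
have uniq a b : i1 a + i2 b = 0 -> a = 0 /\ b = 0.
  move=> ab; have e : i1 a = i2 (- b).
    by apply/eqP; rewrite -[- b]add0r mhomB mhom0 add0r -subr_eq0 opprK ab.
  have a0 : i1 a = 0.
    apply/eqP; rewrite -memv0 -UV0 memv_cap; apply/andP; split.
      by apply/i1U; exists a.
    by apply/i2V; exists (- b).
  move: ab; rewrite a0 add0r => /(proj1 (mhom_injP i2) ii2); split=> //.
  exact: (proj1 (mhom_injP i1) ii1).
have [|D [p1 [p2 [q [qs qE D0]]]]] := copairing (i1 := i1) (i2 := i2).
  move=> y; have /memv_addP[u uU [v vV ->]] : y \in (U + V)%VS by rewrite UV1 memvf.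
  by have [a <-] := proj1 (i1U u) uU; have [b <-] := proj1 (i2V v) vV; exists a, b.
have qi : injective q.
  by apply/mhom_injP => z; rewrite qE => /uniq[z1 z2]; apply: D0.
have [g [qg gq]] := surj_inverse qi qs.
exists N1, N2, i1, i2, (mhom_comp p1 g), (mhom_comp p2 g).
split.
- move=> y; have [|/eqP] := uniq (p1 (g (i1 y)) - y) (p2 (g (i1 y))).
    by rewrite mhomB addrAC -qE qg subrr.
  by rewrite subr_eq0 mhom_compE => /eqP.
- move=> y; have [|_ /eqP] := uniq (p1 (g (i2 y))) (p2 (g (i2 y)) - y).
    by rewrite mhomB addrA -qE qg subrr.
  by rewrite subr_eq0 mhom_compE => /eqP.
- by move=> z; rewrite !mhom_compE -qE qg.
- move=> s1; apply: V0; rewrite -UV0 -[LHS]capfv; congr (_ :&: _)%VS.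
  by apply/vspaceP => y; rewrite memvf; apply/esym/i1U/s1.
- move=> s2; apply: U0; rewrite -UV0 -[LHS]capvf; congr (_ :&: _)%VS.
  by apply/vspaceP => y; rewrite memvf; apply/esym/i2V/s2.
Qed.

(** Statements that hold for the zero module and for indecomposable projectives
    and pass to direct sums hold for all projectives.  This is the only form in
    which a decomposition into indecomposables is needed. *)
Lemma projective_induction (Q : fdmod A -> Prop) :
  (forall P, (forall x : P, x = 0) -> Q P) ->
  (forall P, projective P -> indecomposable P -> Q P) ->
  (forall P P1 P2 (i1 : mhom P1 P) (i2 : mhom P2 P) (r1 : mhom P P1) (r2 : mhom P P2),
    (forall y, r1 (i1 y) = y) -> (forall y, r2 (i2 y) = y) ->
    (forall z, z = i1 (r1 z) + i2 (r2 z)) -> Q P1 -> Q P2 -> Q P) ->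
  forall P, projective P -> Q P.
Proof.
move=> Q0 Qind Qsum P pP.
have [n] := ubnP (\dim {:P}); elim: n P pP => // n IH P pP leP.
have [P0|/not_all_ex_not[x /eqP x0]] := classic (forall x : P, x = 0); first exact: Q0.
have [iP|nP] := classic (indecomposable P); first exact: Qind.
have [P1 [P2 [i1 [i2 [r1 [r2 [r1i1 r2i2 PE ns1 ns2]]]]]]] := decomposable_split x0 nP.
apply: (Qsum _ _ _ _ _ _ _ r1i1 r2i2 PE); apply: IH.
- exact: retract_projective r1i1 pP.
- apply: leq_trans (dim_lt_inj (can_inj r1i1) ns1) _; exact: leP.
- exact: retract_projective r2i2 pP.
- apply: leq_trans (dim_lt_inj (can_inj r2i2) ns2) _; exact: leP.
Qed.

End ProjectiveModules.

(** * Weakly symmetric algebras *)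

Section WeaklySymmetric.
Variables (K : fieldType) (A : fdalg K).
Implicit Types L M N P T : fdmod A.
Hypothesis A_ws : weakly_symmetric A.

(** A simple quotient T of P is a quotient of the top of P, so of the isomorphic
    socle.  As the socle is the sum of the simple submodules, one of these maps
    isomorphically onto T; otherwise all of them would lie in the kernel. *)
Lemma top_in_socle P T : projective P -> indecomposable P -> simple T ->
  has_hom P T -> has_hom T P.
Proof.
move=> pP iP sT [f [x fx]]; apply: NNPP => nTP.
have [T0 [S0 [[p [ps p0]] [i [ii iS]] [phi [psi [psiphi _]]]]]] := proj2 A_ws P pP iP.
have kf y : p y = 0 -> f y = 0.
  by move=> /p0/(_ _ (lker_maximal sT fx)); rewrite memv_ker => /eqP.
have [f1 f1E] := factor_through_surj ps kf.
have phiK y : psi (phi y) = y.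
  by rewrite -mhom_compE psiphi mhom_idE.
pose h := mhom_comp f1 psi.
have ih : (mhom_fun i @: lker h <= limg i)%VS by rewrite limgS ?subvf.
have sker : submodule (mhom_fun i @: lker h)%VS.
  move=> a _ /memv_imgP[y yk ->]; rewrite -mhomP memv_img //; exact: sub_lker.
have : i (phi (p x)) \in (mhom_fun i @: lker h)%VS.
  have /iS : exists s, i s = i (phi (p x)) by exists (phi (p x)).
  apply=> // S sS; have [T1 [j [sT1 ji jS]]] := simple_sub_module sS.
  apply/subvP => y yS; have [z zE] := proj1 (jS y) yS.
  have Ssoc w : in_soc (j w) by move=> U _ /(_ S sS)/subvP; apply; apply/jS; exists w.
  have [j' j'E] : exists j' : mhom T1 S0, forall w, i (j' w) = j w.
    by apply: lift_along_inj => // w; apply/iS.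
  rewrite -zE -j'E memv_img // memv_ker; apply/negPn/negP => hz.
  have [|g [_ gh]] := @schur _ _ _ _ (mhom_comp h j') z sT1 sT.
    by rewrite mhom_compE.
  apply: nTP; apply: (has_hom_comp (g := j) (f := g) (x := h (j' z))).
  rewrite -(mhom_compE h j') gh; apply: contraNneq hz.
  by move=> /(proj1 (mhom_injP j) ji) ->; rewrite !mhom0.
case/memv_imgP => w; rewrite memv_ker => hw /ii E; move: hw.
by rewrite -E mhom_compE phiK f1E (negPf fx).
Qed.

(** Conversely T lies in the socle of P, hence maps to the top of P.  As the
    maximal submodules of the top meet in zero, the image of T is not contained
    in one of them, and the quotient by that one is isomorphic to T. *)
Lemma socle_in_top P T : projective P -> indecomposable P -> simple T ->
  has_hom T P -> has_hom P T.
Proof.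
move=> pP iP sT [f [x fx]]; have fi := simple_inj sT fx.
have [T0 [S0 [[p [ps p0]] [i [ii iS]] [phi [psi [psiphi phipsi]]]]]] := proj2 A_ws P pP iP.
have psiK y : phi (psi y) = y by rewrite -mhom_compE phipsi mhom_idE.
have [g gE] : exists g : mhom T S0, forall w, i (g w) = f w.
  apply: lift_along_inj => // w; apply/iS => U _ /(_ _ (image_simple_sub sT fi)).
  by move/subvP; apply; apply/mem_limg; exists w.
have [y yE] := ps (psi (g x)).
have [V maxV yV] : exists2 V, maximal_sub V & y \notin V.
  apply: NNPP => nV; move/eqP: fx; apply; rewrite -gE -[g x]psiK -yE.
  rewrite (proj2 (p0 y)) ?mhom0 // => V maxV; apply/negPn/negP => yV.
  by apply: nV; exists V.
have [Q [q [qs qV]]] := quotient_module (let: And3 sV _ _ := maxV in sV).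
have sQ := maximal_quotient_simple maxV qs qV.
have [q1 q1E] : exists q1 : mhom T0 Q, forall w, q1 (p w) = q w.
  by apply: factor_through_surj => // w /p0 rw; apply/qV/rw.
have qy : q y != 0 by apply: contra yV => /eqP/qV.
have [|r [_ rE]] := @schur _ _ _ _ (mhom_comp q1 (mhom_comp psi g)) x sT sQ.
  by rewrite !mhom_compE -yE q1E.
apply: (has_hom_comp (g := r) (f := q) (x := y)).
have <- : mhom_comp q1 (mhom_comp psi g) x = q y by rewrite !mhom_compE -yE q1E.
by rewrite rE; apply: contraNneq fx => ->; rewrite mhom0.
Qed.

Lemma projective_top_in_socle P T : projective P -> simple T ->
  has_hom P T -> has_hom T P.
Proof.
move=> pP sT; elim/projective_induction: P / pP => [P P0|P pP iP|].
- by case=> f [x]; rewrite (P0 x) mhom0 eqxx.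
- exact: top_in_socle.
move=> P P1 P2 i1 i2 r1 r2 r1i1 r2i2 PE IH1 IH2 [f [x fx]].
have [[g [y gy]]|n1] := classic (has_hom T P1).
  apply: (has_hom_comp (g := i1) (f := g) (x := y)).
  by apply: contraNneq gy => iy; rewrite -[g y]r1i1 iy mhom0.
have [[g [y gy]]|n2] := classic (has_hom T P2).
  apply: (has_hom_comp (g := i2) (f := g) (x := y)).
  by apply: contraNneq gy => iy; rewrite -[g y]r2i2 iy mhom0.
case/eqP: fx; rewrite (PE x) mhomD.
have -> : f (i1 (r1 x)) = 0.
  by apply/eqP/negPn/negP => h; apply/n1/IH1/(has_hom_comp h).
by rewrite add0r; apply/eqP/negPn/negP => h; apply/n2/IH2/(has_hom_comp h).
Qed.

End WeaklySymmetric.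


(** * Extensions of projective modules *)

Section ExtensionsOfProjectives.
Variables (K : fieldType) (A : fdalg K).
Implicit Types X Y Z P : fdmod A.

Lemma zero_module : exists Z : fdmod A, forall x : Z, x = 0.
Proof.
have [|Z [i [ii iU]]] := @submodule_module _ A (regular A) 0%VS.
  by move=> a x; rewrite !memv0 => /eqP ->; rewrite act0.
exists Z => x; apply: (proj1 (mhom_injP i) ii).
by apply/eqP; rewrite -memv0; apply/iU; exists x.
Qed.

(** Both sequences split, so the middle terms are related through the retraction
    r onto Y of the first and the section t' of the second. *)
Lemma ses_mor_projective P Y (s s' : ses P Y) : projective P ->
  ses_mor (mhom_id P) (mhom_id Y) s s'.
Proof.
case: s => E i p ex; case: s' => E' i' p' ex' pP; rewrite /ses_mor /=.
have [ii ps ip] := ex; have [ii' ps' ip'] := ex'.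
have [t tE] := projective_lift (mhom_id P) pP ps.
have [t' t'E] := projective_lift (mhom_id P) pP ps'.
have pi z : p (i z) = 0 by apply/ip; exists z.
have pi' z : p' (i' z) = 0 by apply/ip'; exists z.
have [d dE] : exists d : mhom E E, forall x, d x = x - t (p x).
  apply: mhom_ofP => [k x y|a x]; last by rewrite !mhomP actB.
  by rewrite !mhomL scalerBr opprD addrACA.
have [r rE] : exists r : mhom E Y, forall x, i (r x) = x - t (p x).
  have [|r rE] := lift_along_inj (i := i) (f := d) ii.
    by move=> x; apply/ip; rewrite dE mhomB tE mhom_idE subrr.
  by exists r => x; rewrite rE.
exists (mhom_add (mhom_comp i' r) (mhom_comp t' p)).
split; apply: mhom_ext => x; rewrite !mhom_compE mhom_addE !mhom_compE ?mhom_idE.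
  rewrite pi mhom0 addr0; congr (i' _); apply: ii.
  by rewrite rE pi mhom0 subr0.
by rewrite mhomD pi' add0r t'E mhom_idE.
Qed.

(** The extension 0 -> Y -> Y -> 0 -> ... -> 0 -> Z -> 0 of the zero module Z maps
    to every extension by Y of the same length, since only its first map is
    nonzero. *)
Lemma yext_of_zero n (Z Y : fdmod A) : (forall x : Z, x = 0) ->
  exists t : yext n Z Y, forall X (al : mhom Z X) (e : yext n X Y),
    yext_mor al (mhom_id Y) t e.
Proof.
move=> Z0; elim: n => [|n [t tP]].
  have [o oE] := mhom_zeroP Y Z.
  have ex : short_exact (mhom_id Y) o.
    split=> [x y|y|x]; rewrite ?mhom_idE //.
      by exists 0; rewrite oE (Z0 y).
    by split=> // _; exists x; rewrite mhom_idE.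
  exists (Ses ex) => X al e; exists (ses_inj e).
  have [_ _ ei] := ses_exact e.
  split; apply: mhom_ext => x; rewrite !mhom_compE /= ?mhom_idE //.
  by rewrite oE mhom0; apply/ei; exists x.
have ex : short_exact (mhom_id Z) (mhom_id Z).
  split=> [x y|y|x]; rewrite ?mhom_idE //; first by exists y; rewrite mhom_idE.
  by split=> _; [exists x; rewrite mhom_idE | exact: Z0].
exists (existT (fun Z' => (ses Z Z' * yext n Z' Y)%type) Z (Ses ex, t)).
move=> X al e; have [ze zeE] := mhom_zeroP Z (projT1 e).
exists ze; split; last exact: tP.
have [ep epE] := mhom_zeroP Z (mid (projT2 e).1).
exists ep; split; apply: mhom_ext => x.
  by rewrite !mhom_compE epE zeE mhom0.
by rewrite !mhom_compE epE (Z0 x) !mhom0.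
Qed.

(** For at least two middle terms every extension of P receives a morphism from the one
    with first step P -> P and zero kernel; this connects any two of them. *)
Lemma Ext_projective n P Y : projective P -> Ext_vanishes n P Y.
Proof.
move=> pP; case: n => [|n] e e'.
  by apply: rst_step; apply: ses_mor_projective.
have [Z Z0] := zero_module.
have [t tP] := @yext_of_zero n Z Y Z0.
have [o oE] := mhom_zeroP Z P.
have ex : short_exact o (mhom_id P).
  split=> [x y _|y|x]; first by rewrite (Z0 x) (Z0 y).
    by exists y; rewrite mhom_idE.
  rewrite mhom_idE; split=> [->|[z <-]]; last exact: oE.
  by exists 0; rewrite oE.
pose e0 : yext n.+1 P Y :=
  existT (fun Z' => (ses P Z' * yext n Z' Y)%type) Z (Ses ex, t).
(* A section of the epimorphism onto P gives the first map of a morphism. *)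
have e0P (d : yext n.+1 P Y) : yext_eq e0 d.
  apply: rst_step; have [ze zeE] := mhom_zeroP Z (projT1 d).
  exists ze; split; last exact: tP.
  have [_ ps _] := ses_exact (projT2 d).1.
  have [s sE] := projective_lift (mhom_id P) pP ps.
  exists s; split; apply: mhom_ext => x; rewrite !mhom_compE /=.
    by rewrite oE zeE !mhom0.
  by rewrite sE /= !id_lfunE.
by apply: rst_trans (e0P e'); apply: rst_sym; apply: e0P.
Qed.

End ExtensionsOfProjectives.

(** * Exact functors *)

Section ExactFunctors.
Variables (K : fieldType) (B A : fdalg K) (F : functor B A).
Hypothesis exF : exact_functor F.
Implicit Types X Y Z : fdmod B.

Lemma fmap_compE X Y Z (g : mhom Y Z) (f : mhom X Y) x :
  fmap F (mhom_comp g f) x = fmap F g (fmap F f x).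
Proof. by rewrite fmap_comp mhom_compE. Qed.

Lemma fmap_idE X (f : mhom X X) x : (forall y, f y = y) -> fmap F f x = x.
Proof.
move=> fE; have -> : f = mhom_id X by apply: mhom_ext => y; rewrite fE mhom_idE.
by rewrite fmap_id mhom_idE.
Qed.

Lemma fmap_zero X Y (f : mhom X Y) x : (forall y, f y = 0) -> fmap F f x = 0.
Proof.
move=> f0; apply: (addrI (fmap F f x)); rewrite addr0 -mhom_addE -(proj1 exF).
by congr (fmap F _ x); apply: mhom_ext => y; rewrite mhom_addE f0 addr0.
Qed.

Lemma fmap_surj X Y (p : mhom X Y) : surj p -> surj (fmap F p).
Proof.
move=> ps; have [N [i [ii iU]]] := submodule_module (sub_lker p).
have ex : short_exact i p.
  by split=> // x; rewrite -iU memv_ker; split=> [->|/eqP].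
by have [_ ? _] := proj2 exF _ _ _ _ _ ex.
Qed.

Lemma fmap_inj X Y (i : mhom X Y) : injective i -> injective (fmap F i).
Proof.
move=> ii; have [Q [p [ps pU]]] := quotient_module (sub_limg i).
have ex : short_exact i p.
  by split=> // x; rewrite pU mem_limg.
by have [? _ _] := proj2 exF _ _ _ _ _ ex.
Qed.

Lemma fmap_kernel X Y (f : mhom X Y) :
  exists (N : fdmod B) (k : mhom N X), injective (fmap F k) /\
    forall x, fmap F f x = 0 <-> exists z, fmap F k z = x.
Proof.
have [I [p [i [ps ii ipE]]]] := image_factorization f.
have [N [k [ki kU]]] := submodule_module (sub_lker p).
have ex : short_exact k p.
  by split=> // x; rewrite -kU memv_ker; split=> [->|/eqP].
have [Fki _ FkP] := proj2 exF _ _ _ _ _ ex.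
exists N, k; split=> // x; rewrite -FkP.
have -> : f = mhom_comp i p by apply: mhom_ext => z; rewrite mhom_compE ipE.
rewrite fmap_compE; split=> [|->]; last exact: mhom0.
exact: (proj1 (mhom_injP _) (fmap_inj ii)).
Qed.

Lemma fmap_cokernel X Y (f : mhom X Y) :
  exists (Q : fdmod B) (q : mhom Y Q), surj (fmap F q) /\
    forall y, fmap F q y = 0 <-> exists x, fmap F f x = y.
Proof.
have [I [p [i [ps ii ipE]]]] := image_factorization f.
have [Q [q [qs qU]]] := quotient_module (sub_limg i).
have ex : short_exact i q by split=> // x; rewrite qU mem_limg.
have [_ Fqs FqP] := proj2 exF _ _ _ _ _ ex.
exists Q, q; split=> // y; rewrite FqP.
have -> : f = mhom_comp i p by apply: mhom_ext => z; rewrite mhom_compE ipE.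
split=> [[z <-]|[x <-]]; last by rewrite fmap_compE; exists (fmap F p x).
by have [x <-] := fmap_surj ps z; exists x; rewrite fmap_compE.
Qed.

Lemma ses_map_mor X Y X' Y' (al : mhom X X') (be : mhom Y Y')
    (s : ses X Y) (s' : ses X' Y') :
  ses_mor al be s s' ->
  ses_mor (fmap F al) (fmap F be) (ses_map exF s) (ses_map exF s').
Proof.
by case=> ep [e1 e2]; exists (fmap F ep); rewrite -!fmap_comp e1 e2.
Qed.

Lemma yext_map_mor n X Y X' Y' (al : mhom X X') (be : mhom Y Y')
    (e : yext n X Y) (e' : yext n X' Y') :
  yext_mor al be e e' ->
  yext_mor (fmap F al) (fmap F be) (yext_map exF e) (yext_map exF e').
Proof.
elim: n X Y X' Y' al be e e' => [|n IH] X Y X' Y' al be e e'.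
  exact: ses_map_mor.
by case=> ze [m1 m2]; exists (fmap F ze); split; [exact: ses_map_mor | exact: IH].
Qed.

Lemma yext_map_eq n X Y (e e' : yext n X Y) :
  yext_eq e e' -> yext_eq (yext_map exF e) (yext_map exF e').
Proof.
elim=> [d d' m|d|d d' _ IH|d1 d2 d3 _ IH1 _ IH2].
- by apply: rst_step; have := yext_map_mor m; rewrite !fmap_id.
- exact: rst_refl.
- exact: rst_sym.
- exact: rst_trans IH1 IH2.
Qed.

Lemma Ext_iso_vanishes n X Y : Ext_iso exF n X Y -> Ext_vanishes n X Y ->
  Ext_vanishes n (F X) (F Y).
Proof.
move=> [_ onto] van d d'; have [e de] := onto d; have [e' de'] := onto d'.
apply: rst_trans (rst_sym _ _ _ _ de) _.
exact: rst_trans (yext_map_eq (van e e')) de'.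
Qed.

(** Images under F of arbitrary modules cover everything as soon as they cover
    the regular module, because these images are closed under direct sums.  The
    class C records a further property of the modules X that are used, if it
    holds for Y and is inherited by direct sums. *)
Lemma cover_by_images (C : fdmod B -> Prop) Y (f : mhom (F Y) (regular A)) :
  (forall Z, (forall x : Z, x = 0) -> C Z) ->
  (forall X1 X2 D (i1 : mhom X1 D) (i2 : mhom X2 D) (p1 : mhom D X1) (p2 : mhom D X2),
     (forall z, z = i1 (p1 z) + i2 (p2 z)) -> C X1 -> C X2 -> C D) ->
  C Y -> surj f ->
  forall M : fdmod A, exists (X : fdmod B) (g : mhom (F X) M), C X /\ surj g.
Proof.
move=> C0 CD CY fs M.
suff [X [g [CX gP]]] : exists (X : fdmod B) (g : mhom (F X) M),
    C X /\ forall m, m \in (vbasis {:M} : seq M) -> m \in limg g.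
  exists X, g; split=> //; apply/surj_limg/eqP; rewrite eqEsubv subvf.
  rewrite -(span_basis (vbasisP {:M})); apply/span_subvP => m; exact: gP.
elim: (vbasis _ : seq M) => [|m s [X [g [CX gP]]]].
  have [Z Z0] := zero_module B; have [g _] := mhom_zeroP (F Z) M.
  by exists Z, g; split=> //; exact: C0.
have [D [i1 [i2 [p1 [p2 [[p1i1 p2i2] p2i1 p1i2 DE]]]]]] := biproduct Y X.
have [h hE] := regular_hom m.
pose q := mhom_add (mhom_comp h (mhom_comp f (fmap F p1))) (mhom_comp g (fmap F p2)).
have qE z : q z = h (f (fmap F p1 z)) + g (fmap F p2 z).
  by rewrite mhom_addE !mhom_compE.
exists D, q; split; first exact: CD DE CY CX.
move=> n; rewrite in_cons => /orP[/eqP ->|/gP/mem_limg[x <-]]; apply/mem_limg.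
  have [y yE] := fs (alg_one : A); exists (fmap F i1 y).
  rewrite qE -!fmap_compE fmap_idE => [|z]; last by rewrite mhom_compE.
  rewrite fmap_zero => [|z]; last by rewrite mhom_compE.
  by rewrite mhom0 addr0 yE hE act1.
exists (fmap F i2 x); rewrite qE -!fmap_compE.
rewrite (fmap_zero (f := mhom_comp p1 i2)) => [|z]; last by rewrite mhom_compE.
rewrite fmap_idE => [|z]; last by rewrite mhom_compE.
by rewrite !mhom0 add0r.
Qed.

End ExactFunctors.

(** * Fully faithful functors *)

Section FullyFaithful.
Variables (K : fieldType) (B A : fdalg K) (F : functor B A).
Hypothesis F_ff : fully_faithful F.

Lemma fmap_full X Y (g : mhom (F X) (F Y)) : exists f, fmap F f = g.
Proof. by have [h _ hK] := F_ff X Y; exists (h g). Qed.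

Lemma fmap_faithful X Y (f g : mhom X Y) : fmap F f = fmap F g -> f = g.
Proof. by move=> fg; apply: (bij_inj (F_ff X Y)). Qed.

Lemma equivalence_of_ess_surj :
  (forall N : fdmod A, exists X, isomorphic (F X) N) -> equivalence F.
Proof.
move=> es; pose cid := @constructive_indefinite_description.
pose G0 N := proj1_sig (cid _ _ (es N)).
pose phiS N := cid _ _ (proj2_sig (cid _ _ (es N))).
pose phi N : mhom (F (G0 N)) N := proj1_sig (phiS N).
pose psiS N := cid _ _ (proj2_sig (phiS N)).
pose psi N : mhom N (F (G0 N)) := proj1_sig (psiS N).
have psiK N x : psi N (phi N x) = x.
  by rewrite -mhom_compE (proj1 (proj2_sig (psiS N))) mhom_idE.
have phiK N y : phi N (psi N y) = y.
  by rewrite -mhom_compE (proj2 (proj2_sig (psiS N))) mhom_idE.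
pose lift X Y (g : mhom (F X) (F Y)) : mhom X Y := proj1_sig (cid _ _ (fmap_full g)).
have liftK X Y (g : mhom (F X) (F Y)) : fmap F (lift _ _ g) = g.
  exact: proj2_sig (cid _ _ (fmap_full g)).
pose G1 M N (f : mhom M N) := lift _ _ (mhom_comp (psi N) (mhom_comp f (phi M))).
have G1E M N (f : mhom M N) z : fmap F (G1 _ _ f) z = psi N (f (phi M z)).
  by rewrite liftK !mhom_compE.
have G1_id N : G1 _ _ (mhom_id N) = mhom_id (G0 N).
  apply/fmap_faithful/mhom_ext => z.
  by rewrite G1E mhom_idE psiK fmap_id mhom_idE.
have G1_comp L M N (g : mhom M N) (f : mhom L M) :
    G1 _ _ (mhom_comp g f) = mhom_comp (G1 _ _ g) (G1 _ _ f).
  apply/fmap_faithful/mhom_ext => z.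
  by rewrite fmap_comp mhom_compE !G1E mhom_compE phiK.
exists (Functor G1_id G1_comp); split.
  exists (fun X => lift _ _ (phi (F X))); split=> [X|X Y f].
    exists (lift _ _ (psi (F X))).
    split; apply/fmap_faithful/mhom_ext => z.
      by rewrite fmap_compE !liftK psiK fmap_id mhom_idE.
    by rewrite fmap_compE !liftK phiK fmap_id mhom_idE.
  apply/fmap_faithful/mhom_ext => z.
  by rewrite !fmap_compE !liftK !mhom_compE phiK.
exists phi; split=> [N|M N f].
  by exists (psi N); split; apply/mhom_ext => z; rewrite mhom_compE ?psiK ?phiK mhom_idE.
by apply: mhom_ext => z; rewrite !mhom_compE G1E phiK.
Qed.

End FullyFaithful.

(** * Homological embeddings into weakly symmetric algebras *)

Section Embedding.
Variables (K : fieldType) (B A : fdalg K) (F : functor B A).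
Hypothesis A_ws : weakly_symmetric A.
Hypothesis F_ff : fully_faithful F.
Hypothesis exF : exact_functor F.
Let M := F (regular B).
Hypothesis projM : projective M.

Lemma exact_functor_id : exact_functor (functor_id B).
Proof. by []. Qed.

(** X is a quotient of a finite direct sum of copies of the regular module, and
    thus F X one of copies of M. *)
Lemma has_hom_of_image X T : has_hom (F X) T -> has_hom M T.
Proof.
move=> [f [x fx]]; apply: NNPP => nT.
pose C Y := forall (g : mhom (F Y) T) y, g y = 0.
have [|||Y [g [CY gs]]] := @cover_by_images _ _ _ _ exact_functor_id C (regular B)
  (mhom_id (regular B)) _ _ (no_hom nT) _ X.
- move=> Z Z0 g y; have [o oE] := mhom_zeroP Z Z.
  have <- : fmap F (mhom_id Z) y = y by rewrite fmap_id mhom_idE.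
  by rewrite (fmap_zero exF) ?mhom0 // => z; rewrite mhom_idE Z0.
- move=> X1 X2 D i1 i2 p1 p2 DE C1 C2 g y.
  have <- : fmap F (mhom_add (mhom_comp i1 p1) (mhom_comp i2 p2)) y = y.
    by apply: fmap_idE => z; rewrite mhom_addE !mhom_compE -DE.
  rewrite (proj1 exF) mhom_addE !fmap_compE mhomD.
  by rewrite -(mhom_compE g) C1 -(mhom_compE g) C2 addr0.
- by move=> y; exists y; rewrite mhom_idE.
have [y yE] := fmap_surj exF (p := g) gs x.
by case/eqP: fx; rewrite -yE -mhom_compE CY.
Qed.

(** A simple quotient T of F X receives a nonzero map from M, so by
    [projective_top_in_socle] it embeds into M.  The composite F X -> T -> M is
    in the image of F, and thus so is the kernel of F X -> T; now induct on the
    dimension of F X. *)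
Lemma has_hom_subquotient X N Q (n : mhom N (F X)) (q : mhom N Q) (y : Q) :
  injective n -> surj q -> y != 0 -> has_hom M Q.
Proof.
have [d] := ubnP (\dim {:F X}); elim: d X N Q n q y => // d IH X N Q n q y led ni qs y0.
have [w wE] := qs y.
have w0 : n w != 0.
  apply: contraNneq y0 => /(proj1 (mhom_injP n) ni) w0.
  by rewrite -wE w0 mhom0.
have [T [p [sT ps]]] := simple_quotient w0.
have [[t t0] _] := sT.
have MT : has_hom M T.
  by have [z zE] := ps t; apply: (@has_hom_of_image X); exists p, z; rewrite zE.
have [j [u ju]] := projective_top_in_socle A_ws projM sT MT.
have ji := simple_inj sT ju.
have [k kE] := fmap_full F_ff (mhom_comp j p).
have [X' [kk [kki kkP]]] := fmap_kernel exF k.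
have kerp z : p z = 0 <-> exists x', fmap F kk x' = z.
  rewrite -kkP kE mhom_compE; split=> [->|]; first exact: mhom0.
  exact: (proj1 (mhom_injP j) ji).
pose g := mhom_comp p n.
have [N1 [i1 [ii1 i1U]]] := submodule_module (sub_lker g).
have [n1 n1E] : exists n1 : mhom N1 (F X'), forall z, fmap F kk (n1 z) = n (i1 z).
  have [z|h hE] := lift_along_inj (f := mhom_comp n i1) kki.
    rewrite mhom_compE; apply/kerp; rewrite -mhom_compE.
    by apply/eqP; rewrite -memv_ker; apply/i1U; exists z.
  by exists h => z; rewrite hE mhom_compE.
have n1i : injective n1.
  by move=> a b ab; apply/ii1/ni; rewrite -!n1E ab.
(* Either the kernel of N -> T has a nonzero image in Q, or Q is a quotient of T. *)
have [[z qz]|nz] := classic (exists z, q (i1 z) != 0).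
  have [I [p' [i' [ps' ii' pE']]]] := image_factorization (mhom_comp q i1).
  have pz : p' z != 0.
    by apply: contraNneq qz => pz; rewrite -mhom_compE -pE' pz mhom0.
  have [|f [m fm]] := IH X' N1 I n1 p' (p' z) _ n1i ps' pz.
    rewrite -ltnS; apply: leq_trans led; rewrite ltnS; apply: dim_lt_inj kki _.
    move=> kks; case/eqP: t0; have [v <-] := ps t; apply/kerp; exact: kks.
  apply: (has_hom_comp (g := i') (f := f) (x := m)).
  by apply: contraNneq fm => /(proj1 (mhom_injP i') ii') ->.
have gq x : g x = 0 -> q x = 0.
  move=> gx; have /i1U[z <-] : x \in lker g by rewrite memv_ker gx.
  by apply/eqP/negPn/negP => qz; apply: nz; exists z.
have gw : g w != 0 by apply: contraNneq y0 => /gq; rewrite wE => ->.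
have [h hE] := factor_through_surj (simple_surj sT gw) gq.
have [f [m fm]] := MT; have [m' m'E] := simple_surj sT fm (g w).
apply: (has_hom_comp (g := h) (f := f) (x := m')).
by rewrite m'E hE wE.
Qed.

(** A simple submodule T of the image of a map M -> P is a subquotient of M,
    hence a quotient of M, and a quotient of P since it lies in the socle of P.
    A lift M -> P of the map onto T is onto, as its image and the kernel of
    P -> T span P. *)
Lemma cover_or_no_hom P : projective P -> indecomposable P -> has_hom M P ->
  exists f : mhom M P, surj f.
Proof.
move=> pP iP [f [m fm]].
have [I [p [i [ps ii ipE]]]] := image_factorization f.
have pm : p m != 0 by apply: contraNneq fm => pm; rewrite -ipE pm mhom0.
have [T [j [sT ji]]] := simple_submodule pm.
have [[t t0] _] := sT.
have jt : j t != 0 by apply: contraNneq t0 => /(proj1 (mhom_injP j) ji) ->.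
have [Q [r [rs rU]]] := quotient_module (sub_limg j).
have [N [n [ni nU]]] := submodule_module (sub_lker (mhom_comp r p)).
have memN x : p x \in limg j <-> exists z, n z = x.
  by rewrite -nU memv_ker mhom_compE -rU; split=> [->|/eqP].
have [q qE] : exists q : mhom N T, forall z, j (q z) = p (n z).
  have [z|h hE] := lift_along_inj (f := mhom_comp p n) ji.
    by rewrite mhom_compE; apply/mem_limg/memN; exists z.
  by exists h => z; rewrite hE mhom_compE.
have qs : surj q.
  move=> y; have [x xE] := ps (j y).
  have /memN[z zE] : p x \in limg j by apply/mem_limg; exists y.
  by exists z; apply: ji; rewrite qE zE xE.
have [s [m' sm']] := has_hom_subquotient ni qs t0.
have [|u [x ux]] := socle_in_top A_ws pP iP sT.
  apply: (has_hom_comp (g := i) (f := j) (x := t)).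
  by apply: contraNneq jt => /(proj1 (mhom_injP i) ii) ->.
have [g gE] := projective_lift s projM (simple_surj sT ux).
exists g; apply/surj_limg.
apply: (indecomposable_projective_join pP iP (sub_lker u) (sub_limg g)).
  apply/vspaceP => y; rewrite memvf.
  have [v vE] := simple_surj sT sm' (u y).
  rewrite -(subrK (g v) y); apply: memv_add; last by apply/mem_limg; exists v.
  by rewrite memv_ker mhomB gE vE subrr.
by move=> kE; move: (memvf x); rewrite -kE memv_ker (negPf ux).
Qed.

(** F Y is a sum of copies of M that covers the summands of P which are quotients
    of M, and H is the sum of the others. *)
Lemma projective_generated_part P : projective P ->
  exists (Y : fdmod B) (H : fdmod A) (f : mhom (F Y) P) (h : mhom H P),
    ~ has_hom M H /\ forall x, exists y z, x = f y + h z.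
Proof.
have [Z Z0] := zero_module A.
have nZ : ~ has_hom M Z by case=> f [x]; rewrite (Z0 (f x)) eqxx.
move=> pP; elim/projective_induction: P / pP => [P P0|P pP iP|P P1 P2 i1 i2 r1 r2 _ _ PE].
- have [f _] := mhom_zeroP M P; have [h _] := mhom_zeroP Z P.
  by exists (regular B), Z, f, h; split=> // x; exists 0, 0; rewrite [LHS]P0 [RHS]P0.
- have [/(cover_or_no_hom pP iP)[f fs]|nP] := classic (has_hom M P).
    have [h hE] := mhom_zeroP Z P; exists (regular B), Z, f, h; split=> // x.
    by have [y <-] := fs x; exists y, 0; rewrite hE addr0.
  have [f fE] := mhom_zeroP M P; exists (regular B), P, f, (mhom_id P).
  by split=> // x; exists 0, x; rewrite fE mhom_idE add0r.
move=> [Y1 [H1 [f1 [h1 [n1 E1]]]]] [Y2 [H2 [f2 [h2 [n2 E2]]]]].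
have [Y [a1 [a2 [p1 [p2 [[p1a1 p2a2] p2a1 p1a2 YE]]]]]] := biproduct Y1 Y2.
have [H [b1 [b2 [q1 [q2 [[q1b1 q2b2] q2b1 q1b2 HE]]]]]] := biproduct H1 H2.
pose f := mhom_add (mhom_comp (mhom_comp i1 f1) (fmap F p1))
                   (mhom_comp (mhom_comp i2 f2) (fmap F p2)).
pose h := mhom_add (mhom_comp (mhom_comp i1 h1) q1) (mhom_comp (mhom_comp i2 h2) q2).
exists Y, H, f, h; split=> [[g [m gm]]|x].
  case/eqP: gm; rewrite (HE (g m)) -(mhom_compE q1 g) -(mhom_compE q2 g).
  by rewrite (no_hom n1) (no_hom n2) !mhom0 addr0.
have [y1 [z1 x1E]] := E1 (r1 x); have [y2 [z2 x2E]] := E2 (r2 x).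
exists (fmap F a1 y1 + fmap F a2 y2), (b1 z1 + b2 z2).
rewrite !mhom_addE !mhom_compE !mhomD q1b1 q2b1 q1b2 q2b2 -!fmap_compE.
rewrite (fmap_idE (f := mhom_comp p1 a1)) => [|z]; last by rewrite mhom_compE.
rewrite (fmap_idE (f := mhom_comp p2 a2)) => [|z]; last by rewrite mhom_compE.
rewrite (fmap_zero exF (f := mhom_comp p1 a2)) => [|z]; last by rewrite mhom_compE.
rewrite (fmap_zero exF (f := mhom_comp p2 a1)) => [|z]; last by rewrite mhom_compE.
rewrite !mhom0 !add0r !addr0 addrACA -!mhomD -x1E -x2E; exact: PE.
Qed.

Lemma no_hom_from_image X H : ~ has_hom M H -> ~ has_hom (F X) H.
Proof. by move=> nH /has_hom_of_image. Qed.

(** A map from H to F X lands in a subquotient of F X; maps from M to its image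
    lift to H. *)
Lemma no_hom_to_image X H : ~ has_hom M H -> ~ has_hom H (F X).
Proof.
move=> nH [w [z wz]]; have [D [p [i [ps ii ipE]]]] := image_factorization w.
have pz : p z != 0 by apply: contraNneq wz => pz; rewrite -ipE pz mhom0.
have ids : surj (mhom_id D) by move=> y; exists y; rewrite mhom_idE.
have [f [m fm]] := has_hom_subquotient ii ids pz.
have [g gE] := projective_lift f projM ps.
by apply: nH; exists g, m; apply: contraNneq fm => gm; rewrite -gE gm mhom0.
Qed.

(** The regular module is the sum of the images of F Y and of H.  A product of an
    element of one image with an element of the other is computed by a map
    between F Y and H, which is zero.  Hence the components of 1 are central
    idempotents, and connectedness applies.  If 1 comes from H, a simple quotient
    of M would be a quotient of H, and M -> H would be nonzero by lifting. *)
Lemma generator_or_zero : connected A ->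
  (exists (Y : fdmod B) (f : mhom (F Y) (regular A)), surj f) \/
  forall m : M, m = 0.
Proof.
move=> [_ conn].
have [Y [H [f [h [nH AE]]]]] := projective_generated_part (regular_projective (A := A)).
have [y0 [z0 oneE]] := AE (alg_one : A).
have fa a y : f (act a y) = alg_mul a (f y) by rewrite mhomP.
have ha a z : h (act a z) = alg_mul a (h z) by rewrite mhomP.
have fh y z : alg_mul (f y) (h z) = 0.
  rewrite -ha; have [r rE] := regular_hom z.
  rewrite -rE -(mhom_compE r f) (no_hom (no_hom_from_image nH)); exact: (mhom0 h).
have hf y z : alg_mul (h z) (f y) = 0.
  rewrite -fa; have [r rE] := regular_hom y.
  rewrite -rE -(mhom_compE r h) (no_hom (no_hom_to_image nH)); exact: (mhom0 f).
have mulD a b c : alg_mul a (b + c) = alg_mul a b + alg_mul a c :> A.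
  by have := alg_mul_linear_r 1 a b c; rewrite !scale1r.
have mulDl a b c : alg_mul (a + b) c = alg_mul a c + alg_mul b c :> A.
  by have := alg_mul_linear_l 1 a b c; rewrite !scale1r.
have [| |e0|e1] := conn (f y0).
- by have := alg_mul1r (f y0 : A); rewrite oneE mulD fh addr0.
- move=> a.
  have -> : alg_mul a (f y0) = alg_mul (f y0) (alg_mul a (f y0)).
    by rewrite -{1}[alg_mul a _]alg_mul1l oneE mulDl -fa hf addr0.
  have -> : alg_mul (f y0) a = alg_mul (alg_mul (f y0) a) (f y0).
    rewrite -{1}[alg_mul _ a]alg_mul1r oneE mulD.
    by rewrite -[X in _ + X]alg_mulA -ha fh addr0.
  exact: alg_mulA.
- right=> m; apply/eqP/negPn/negP => m0.
  have hs : surj h.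
    move=> a; exists (act a z0); rewrite ha.
    by rewrite -[RHS](alg_mul1r (a : A)) oneE e0 add0r.
  have [T [p [sT ps]]] := simple_quotient m0; have [[t t0] _] := sT.
  have [r rE] := regular_hom t.
  have rhs : surj (mhom_comp r h).
    have [z zE] := hs (alg_one : A).
    by apply: (simple_surj (x := z) sT); rewrite mhom_compE zE rE act1.
  have [g gE] := projective_lift p projM rhs.
  apply: nH; have [v vE] := ps t; exists g, v.
  by apply: contraNneq t0 => gv; rewrite -vE -gE gv mhom0.
left; exists Y, f => a; exists (act a y0).
by rewrite fa e1 alg_mul1r.
Qed.

(** Faithfulness makes the identity of the regular module zero, so that B and
    all its modules are zero. *)
Lemma zero_functor_of_zero : (forall m : M, m = 0) -> zero_functor F.
Proof.
move=> M0 X x; have [o oE] := mhom_zeroP (regular B) (regular B).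
have idE : mhom_id (regular B) = o.
  by apply: (fmap_faithful F_ff); apply: mhom_ext => m; rewrite [LHS]M0 [RHS]M0.
have one0 : (alg_one : B) = 0.
  by rewrite -[LHS](@mhom_idE _ _ (regular B)) idE oE.
rewrite -[x](@mhom_idE _ _ (F X)) -fmap_id (fmap_zero exF) // => y.
by rewrite mhom_idE -(act1 y) one0 act0l.
Qed.

(** N is the cokernel of a map F X' -> F X.  This map is F k for some k, and F
    preserves the cokernel of k. *)
Lemma ess_surj_of_generator Y (f : mhom (F Y) (regular A)) : surj f ->
  forall N : fdmod A, exists X, isomorphic (F X) N.
Proof.
move=> fs N; have cover := cover_by_images exF (C := fun=> True)
  (fun _ _ => I) (fun _ _ _ _ _ _ _ _ _ _ => I) I fs.
have [X [g [_ gs]]] := cover N.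
have [L [i [ii iU]]] := submodule_module (sub_lker g).
have [X' [g' [_ gs']]] := cover L.
have [k kE] := fmap_full F_ff (mhom_comp i g').
have [Q [q [qs qP]]] := fmap_cokernel exF k.
exists Q; apply: iso_of_surj qs gs _ => x; rewrite qP kE.
have -> : g x = 0 <-> x \in lker g by rewrite memv_ker; split=> [->|/eqP].
rewrite iU; split=> [[z <-]|[y <-]]; first by rewrite mhom_compE; exists (g' z).
by have [z <-] := gs' y; exists z; rewrite mhom_compE.
Qed.

End Embedding.

Theorem theorem5p6 (K : closedFieldType) (A B : fdalg K)
    (A_connected : connected A) (A_weakly_symmetric : weakly_symmetric A)
    (A_Tachikawa : Tachikawa A)
    (F : functor B A) (F_embedding : homological_embedding F) :
  zero_functor F \/ equivalence F.
Proof.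
have [F_ff [exF F_ext]] := F_embedding.
have projM : projective (F (regular B)).
  apply: A_Tachikawa => n; apply: Ext_iso_vanishes (F_ext n _ _) _.
  by apply: Ext_projective; apply: regular_projective.
have [[Y [f fs]]|M0] := generator_or_zero A_weakly_symmetric F_ff exF projM A_connected.
  right; apply: (equivalence_of_ess_surj F_ff).
  exact: (ess_surj_of_generator F_ff exF fs).
by left; apply: (zero_functor_of_zero F_ff exF).
Qed.
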